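(* Consider an instance of the Colored Knapsack Problem. The algorithm $\mathtt{DP_2}$ (defined in the context) computes, for all $c\in\{0,1,\dots,m\}$, $t,d\in\{0,1,\dots,n\}$ and $q\in\{0,1,\dots,b\}$, the value $$f(c,t,d,q)=\max\Big\{\sum_{c'=1}^{c}f_{c'}(k_{c'},q_{c'})\ \Big|\ \big((k_1,q_1),\dots,(k_c,q_c)\big)\in\mathcal{S}_1\times\dots\times\mathcal{S}_c,\ \sum_{c'=1}^{c}k_{c'}=t,\ \max_{c'\in\{1,\dots,c\}}k_{c'}=d,\ \sum_{c'=1}^{c}q_{c'}=q\Big\},$$ if a solution satisfying these conditions exists, in at most $\mathcal{O}(b^2\,n^3)$ operations. (For $c=0$ the only solution is the empty one, with $t=d=q=0$ and value $0$.)
   Context: An instance of the Colored Knapsack Problem (CKP) consists of a set of items $\mathcal{I}=\{1,\dots,n\}$ with profits $p_i\in\mathbb{Z}$ (zero and negative profits allowed) and weights $w_i\in\mathbb{Z}_{>0}$, a capacity $b\in\mathbb{Z}_{>0}$ with $b<\sum_{i=1}^n w_i$, a set of colors $\mathcal{C}=\{1,\dots,m\}$, and a color $\kappa_i\in\mathcal{C}$ for each item $i$. For $c\in\mathcal{C}$ let $\mathcal{I}_c=\{i\in\mathcal{I}\mid\kappa_i=c\}$. The color classes $\mathcal{I}_1,\dots,\mathcal{I}_m$ partition the items into nonempty classes (so $m\le n$). For $S\subseteq\mathcal{I}$, $p(S)=\sum_{i\in S}p_i$ and $w(S)=\sum_{i\in S}w_i$. For $c\in\mathcal{C}$, $k\in\{0,\dots,|\mathcal{I}_c|\}$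 and $q\in\{0,\dots,b\}$ let $f_c(k,q)=\max\{p(S)\mid S\subseteq\mathcal{I}_c,\ w(S)=q,\ |S|=k\}$, with $f_c(k,q)=-\infty$ if no such $S$ exists, and let $\mathcal{S}_c=\{(k,q)\mid f_c(k,q)>-\infty\}$. Algorithm $\mathtt{DP_2}$. Initialize a table $f(c,t,d,q)\gets-\infty$ for all $c\in\{0,\dots,m\}$, $t,d\in\{0,\dots,n\}$, $q\in\{0,\dots,b\}$; then set $f(0,0,0,0)\gets0$. For $c=1,2,\dots,m$: determine $\mathcal{S}_c$ and the values $f_c(k,q)$ by the standard item-by-item dynamic program for the knapsack problem with exact cardinality and exact weight restricted to the items of $\mathcal{I}_c$ (the ''inner'' dynamic program, taking $\mathcal{O}(b\,|\mathcal{I}_c|^2)$ operations); then for each $(t,d,q)$ with $f(c-1,t,d,q)>-\infty$ and each $(k,\Delta q)\in\mathcal{S}_c$ with $q+\Delta q\le b$, let $s=(c,\,t+k,\,\max\{d,k\},\,q+\Delta q)$ and set $f(s)\gets\max\{f(s),\ f(c-1,t,d,q)+f_c(k,\Delta q)\}$. Operations are elementary (arithmetic, comparison, table access) at unit cost. *)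

(* Defs.v *)
From mathcomp Require Import all_boot all_order all_algebra.
From mathcomp Require Import constructive_ereal.

Set Implicit Arguments.
Unset Strict Implicit.
Unset Printing Implicit Defensive.

Import Order.TTheory GRing.Theory Num.Theory.

Local Open Scope ereal_scope.
Local Open Scope nat_scope.

(* Items and colors are numbered from 0: the c-th color of the usual 1-based
   numbering is the ordinal of value c - 1. *)
Record ckp := Ckp {
  num_items : nat;
  num_colors : nat;
  profit : 'I_num_items -> int;
  weight : 'I_num_items -> nat;
  capacity : nat;
  color : 'I_num_items -> 'I_num_colors;
  weight_gt0 : forall i, 0 < weight i;
  capacity_gt0 : 0 < capacity;
  capacity_lt_sum : capacity < \sum_i weight i;
  color_surj : forall c, exists i, color i = c }.

Section Specification.
Variable I : ckp.
Local Notation n := (num_items I).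
Local Notation b := (capacity I).

Definition set_profit (S : {set 'I_n}) : int := (\sum_(i in S) profit i)%R.
Definition set_weight (S : {set 'I_n}) : nat := \sum_(i in S) weight i.

Definition color_class (c : nat) : {set 'I_n} := [set i | color i == c :> nat].

(* The maximum over an empty range is -oo. *)
Definition class_value (c k q : nat) : \bar int :=
  \big[maxe/-oo%E]_(S : {set 'I_n} |
      [&& S \subset color_class c, set_weight S == q & #|S| == k])
    (set_profit S)%:E.

Definition class_support (c : nat) : pred (nat * nat) := fun kq =>
  [&& kq.1 <= #|color_class c|, kq.2 <= b & (-oo < class_value c kq.1 kq.2)%E].

(* Since k <= n and q <= b on every class support, restricting the pairs
   (k, q) to the finite type 'I_n.+1 * 'I_b.+1 loses no selection. *)
Definition selection (c : nat) := {ffun 'I_c -> 'I_n.+1 * 'I_b.+1}.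

Definition feasible (c t d q : nat) (x : selection c) : bool :=
  [&& [forall j : 'I_c, class_support j ((x j).1 : nat, (x j).2 : nat)],
      \sum_(j < c) (x j).1 == t,
      \max_(j < c) (x j).1 == d &
      \sum_(j < c) (x j).2 == q].

Definition selection_value (c : nat) (x : selection c) : \bar int :=
  (\sum_(j < c) class_value j (x j).1 (x j).2)%E.

Definition optimal_value (c t d q : nat) : \bar int :=
  \big[maxe/-oo%E]_(x : selection c | feasible t d q x) selection_value x.

End Specification.

(* Unit-cost machine. A command maps a memory to a result, a new memory and
   the number of elementary operations performed. In the programs below every
   [op], [get] and [put] stands for a single arithmetic operation, comparison,
   input access, memory read or memory write, and every loop test is charged. *)

Record memory (n : nat) := Memory {
  tab_f : nat * nat * nat * nat -> \bar int;
  tab_g : nat * nat -> \bar int;       (* inner table, reused for each color *)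
  items_c : seq 'I_n;                  (* items of the current color *)
  size_c : nat;                        (* their number *)
  supp_c : seq (nat * nat) }.          (* finite entries of the inner table *)

Definition cmd (n : nat) (A : Type) := memory n -> A * memory n * nat.

Definition final_memory n A (p : cmd n A) (h : memory n) : memory n :=
  (p h).1.2.
Definition cost n A (p : cmd n A) (h : memory n) : nat := (p h).2.

Section Machine.
Variable n : nat.
Implicit Types h : memory n.

Definition skip : cmd n unit := fun h => (tt, h, 0).
Definition bind A B (p : cmd n A) (r : A -> cmd n B) : cmd n B := fun h =>
  let: (a, h1, k1) := p h in let: (x, h2, k2) := r a h1 in (x, h2, k1 + k2).
Definition op A (a : A) : cmd n A := fun h => (a, h, 1).
Definition get A (r : memory n -> A) : cmd n A := fun h => (r h, h, 1).
Definition put (w : memory n -> memory n) : cmd n unit :=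
  fun h => (tt, w h, 1).

Fixpoint foreach A (s : seq A) (body : A -> cmd n unit) : cmd n unit :=
  if s is x :: s' then
    bind (op true) (fun _ => bind (body x) (fun _ => foreach s' body))
  else bind (op false) (fun _ => skip).

Definition read_f s : cmd n (\bar int) := get (fun h => tab_f h s).
Definition read_g s : cmd n (\bar int) := get (fun h => tab_g h s).
Definition write_f s (v : \bar int) := put (fun h =>
  Memory [eta tab_f h with s |-> v] (tab_g h) (items_c h) (size_c h) (supp_c h)).
Definition write_g s (v : \bar int) := put (fun h =>
  Memory (tab_f h) [eta tab_g h with s |-> v] (items_c h) (size_c h) (supp_c h)).
Definition set_items s := put (fun h =>
  Memory (tab_f h) (tab_g h) s (size_c h) (supp_c h)).
Definition set_size k := put (fun h =>
  Memory (tab_f h) (tab_g h) (items_c h) k (supp_c h)).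
Definition set_supp s := put (fun h =>
  Memory (tab_f h) (tab_g h) (items_c h) (size_c h) s).

End Machine.

Arguments skip {n}.
Arguments op {n A} a.
Arguments read_f {n} s.
Arguments read_g {n} s.
Arguments write_f {n} s v.
Arguments write_g {n} s v.
Arguments set_items {n} s.
Arguments set_size {n} k.
Arguments set_supp {n} s.

Declare Scope cmd_scope.
Delimit Scope cmd_scope with cmd.
Notation "x <-- p ;; r" := (bind p (fun x => r))
  (at level 61, p at next level, right associativity) : cmd_scope.
Notation "p ;; r" := (bind p (fun _ => r))
  (at level 61, right associativity) : cmd_scope.

Section Algorithm.
Variable I : ckp.
Local Notation n := (num_items I).
Local Notation m := (num_colors I).
Local Notation b := (capacity I).
Local Open Scope cmd_scope.

Definition initialize : cmd n unit :=
  foreach (iota 0 m.+1) (fun c =>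
  foreach (iota 0 n.+1) (fun t =>
  foreach (iota 0 n.+1) (fun d =>
  foreach (iota 0 b.+1) (fun q =>
    write_f (c, t, d, q) -oo%E))));;
  write_f (0, 0, 0, 0) 0%E.

Definition collect_class (c : 'I_m) : cmd n unit :=
  set_items [::];;
  set_size 0;;
  foreach (enum 'I_n) (fun i =>
    ci <-- op (color i);;
    same <-- op (ci == c);;
    if same then
      s <-- get (@items_c n);;
      set_items (i :: s);;
      k <-- get (@size_c n);;
      k1 <-- op k.+1;;
      set_size k1
    else skip).

(* Item-by-item knapsack dynamic program with exact cardinality and exact
   weight, in place: k runs downwards, so that the entry (k - 1, q - w_i) read
   while inserting item i does not yet account for i. *)
Definition inner_dp : cmd n unit :=
  nc <-- get (@size_c n);;
  foreach (iota 0 nc.+1) (fun k =>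
  foreach (iota 0 b.+1) (fun q =>
    write_g (k, q) -oo%E));;
  write_g (0, 0) 0%E;;
  s <-- get (@items_c n);;
  foreach s (fun i =>
    p <-- op (profit i);;
    w <-- op (weight i);;
    foreach (rev (iota 1 nc)) (fun k =>
    foreach (iota w (b.+1 - w)) (fun q =>
      k1 <-- op k.-1;;
      q1 <-- op (q - w);;
      v <-- read_g (k1, q1);;
      new <-- op (v + p%:E)%E;;
      old <-- read_g (k, q);;
      best <-- op (maxe old new);;
      write_g (k, q) best))).

Definition collect_support : cmd n unit :=
  nc <-- get (@size_c n);;
  set_supp [::];;
  foreach (iota 0 nc.+1) (fun k =>
  foreach (iota 0 b.+1) (fun q =>
    v <-- read_g (k, q);;
    finite <-- op (-oo < v)%E;;
    if finite then
      s <-- get (@supp_c n);;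
      set_supp ((k, q) :: s)
    else skip)).

(* Passes from layer c to layer c + 1 of the outer table; after the inner
   dynamic program, tab_g holds the values of the current color. *)
Definition outer_step (c : nat) : cmd n unit :=
  foreach (iota 0 n.+1) (fun t =>
  foreach (iota 0 n.+1) (fun d =>
  foreach (iota 0 b.+1) (fun q =>
    v <-- read_f (c, t, d, q);;
    finite <-- op (-oo < v)%E;;
    if finite then
      supp <-- get (@supp_c n);;
      foreach supp (fun kq =>
        let: (k, dq) := kq in
        q1 <-- op (q + dq);;
        fits <-- op (q1 <= b);;
        if fits then
          c1 <-- op c.+1;;
          t1 <-- op (t + k);;
          d1 <-- op (maxn d k);;
          old <-- read_f (c1, t1, d1, q1);;
          u <-- read_g (k, dq);;
          new <-- op (v + u)%E;;
          best <-- op (maxe old new);;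
          write_f (c1, t1, d1, q1) best
        else skip)
    else skip))).

Definition DP2 : cmd n unit :=
  initialize;;
  foreach (enum 'I_m) (fun c =>
    collect_class c;;
    inner_dp;;
    collect_support;;
    outer_step c).

End Algorithm.

Arguments DP2 I : clear implicits.

(* Main.v *)
Require Import Defs.
From mathcomp Require Import all_boot all_order all_algebra.
From mathcomp Require Import constructive_ereal.
From mathcomp Require Import zify.

Set Implicit Arguments.
Unset Strict Implicit.
Unset Printing Implicit Defensive.

Import Order.TTheory GRing.Theory Num.Theory.

Local Open Scope nat_scope.

(** The value of a selection for the first c + 1 colors is the value of its
    restriction to the first c colors plus one class value, while count,
    maximal count and weight are updated by k, max and dq: this is the Bellman
    recursion of the outer table, split into [optimal_value_extend] (extending
    a selection never beats the optimum of the next layer) and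
    [optimal_value_split] (every selection arises by extension). The outer step
    writes only in layer c + 1, and its entries only grow. Hence the entries
    stay below the optimum by the first inequality; and once all pairs of a
    table entry and a support element have been visited, they reach it by the
    second, whatever the order of the visits ([outer_step_runs]).

    The class values come from the inner dynamic program, which adds the items
    one at a time: an optimal subset of A with one more item i either avoids i
    or consists of i and a subset of A with one item less ([subset_valueU1]).
    Since the table is updated in place, the order matters here: with k
    decreasing, row k - 1 still holds the values for A when row k is updated
    ([insert_item_runs]).

    For the cost, let K be the size of a class, N = n + 1 and B = b + 1.
    Initialization costs O(m N^2 B); a color costs O(n) to collect the class,
    O(K^2 B) for the inner dynamic program, and O(N^2 B) times the size of the
    support, which is at most (K + 1) B, for the outer step. Each of these
    costs of a color is O(N^2 B^2 (K + 1)), and the sum of K + 1 over the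
    colors is n + m <= 2 n because the nonempty classes partition the items.
    As n and b are positive, N <= 2 n and B <= 2 b, so O(b^2 n^3) results.

    Values and costs are obtained together, from triples [runs p h k Q] that
    bound the number of operations along with establishing the postcondition,
    so that the bound on the size of the support, a fact about the memory, is
    at hand where the cost of the outer step is computed. *)

(** * The recursions satisfied by the optimal values *)

Lemma bigmaxe_attained (T : finType) (P : pred T) (F : T -> \bar int) :
  \big[maxe/-oo%E]_(i | P i) F i = -oo%E \/
  exists2 i, P i & \big[maxe/-oo%E]_(i | P i) F i = F i.
Proof.
case: (pickP P) => [i Pi | P0]; last by left; rewrite big_pred0.
have [j Pj eqj] := @eq_bigmax _ _ _ -oo%E i P F Pi (fun j _ => leNye (F j)).
by right; exists j.
Qed.

Section Knapsack.
Variable I : ckp.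
Local Notation n := (num_items I).
Local Notation m := (num_colors I).
Local Notation b := (capacity I).
Implicit Types (A S : {set 'I_n}) (i : 'I_n).

(** [class_value I c] is [subset_value (color_class I c)]; arbitrary sets occur
    in the inner dynamic program, which builds the class item by item. *)
Definition subset_value A (k q : nat) : \bar int :=
  \big[maxe/-oo%E]_(S : {set 'I_n} |
      [&& S \subset A, set_weight S == q & #|S| == k]) (set_profit S)%:E.

Lemma subset_value0 k q :
  subset_value set0 k q = if (k == 0) && (q == 0) then 0%E else -oo%E.
Proof.
have W0 : set_weight (set0 : {set 'I_n}) = 0 by rewrite /set_weight big_set0.
have P0 : set_profit (set0 : {set 'I_n}) = 0%R by rewrite /set_profit big_set0.
rewrite /subset_value; case: ifPn => [/andP[/eqP-> /eqP->] | nz].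
  rewrite (big_pred1 set0) ?P0 // => S /=; rewrite subset0.
  by case: eqP => //= ->; rewrite W0 cards0 !eqxx.
rewrite big_pred0 // => S; rewrite subset0; apply: contraNF nz.
by case/and3P=> /eqP-> /eqP<- /eqP<-; rewrite W0 cards0.
Qed.

(** The knapsack recursion: the subsets of i |: A containing i are the i |: S
    with S a subset of A, and i contributes one to the cardinality. *)
Lemma subset_valueU1 A i k q : i \notin A ->
  subset_value (i |: A) k q = maxe (subset_value A k q)
    (if (0 < k) && (weight i <= q)
     then (subset_value A k.-1 (q - weight i) + (profit i)%:E)%E else -oo%E).
Proof.
move=> iA; apply/le_anti/andP; split.
  apply: bigmax_le => [|S /and3P[sSA /eqP wS /eqP cS]]; first exact: leNye.
  rewrite le_max; have [iS | iS] := boolP (i \in S); last first.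
    apply/orP; left; apply: (@Order.TotalTheory.bigmax_sup _ _ _ _ S) => //.
    rewrite wS cS !eqxx !andbT; apply/subsetP=> j jS.
    have := subsetP sSA j jS; rewrite !inE; case: eqP => // ji.
    by rewrite ji (negPf iS) in jS.
  apply/orP; right.
  have wS' : set_weight S = weight i + set_weight (S :\ i).
    by rewrite /set_weight (big_setD1 i).
  have pS' : set_profit S = (set_profit (S :\ i) + profit i)%R.
    by rewrite /set_profit (big_setD1 i iS) addrC.
  have cS' : #|S| = (#|S :\ i|).+1 by rewrite (cardsD1 i) iS.
  rewrite -cS -wS cS' wS' leq_addr /= addKn pS' EFinD leeD2r //.
  apply: (@Order.TotalTheory.bigmax_sup _ _ _ _ (S :\ i)) => //.
  rewrite !eqxx !andbT; apply/subsetP=> j; rewrite in_setD1 => /andP[ji jS].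
  by have := subsetP sSA j jS; rewrite !inE (negPf ji).
rewrite ge_max; apply/andP; split.
  apply: bigmax_le => [|S /and3P[sSA wS cS]]; first exact: leNye.
  apply: (@Order.TotalTheory.bigmax_sup _ _ _ _ S) => //.
  by rewrite wS cS !andbT (subset_trans sSA) // subsetU1.
case: ifP => [/andP[k0 wq] | _]; last exact: leNye.
have [|[S /and3P[sSA /eqP wS /eqP cS] eqv]] := bigmaxe_attained
    (fun S => [&& S \subset A, set_weight S == q - weight i & #|S| == k.-1])
    (fun S => (set_profit S)%:E).
  by rewrite /subset_value => ->; rewrite addNye leNye.
rewrite [subset_value A _ _]eqv.
have iS : i \notin S by apply: contra iA => /(subsetP sSA).
apply: (@Order.TotalTheory.bigmax_sup _ _ _ _ (i |: S)).
  rewrite setUS //= /set_weight big_setU1 //= -/(set_weight S) wS cardsU1 iS cS.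
  rewrite subnKC // eqxx /=; apply/eqP; lia.
by rewrite /set_profit big_setU1 //= addrC EFinD.
Qed.

Lemma class_support_bounds c k q : class_support I c (k, q) -> k <= n /\ q <= b.
Proof.
case/and3P=> /= kc qb _; split=> //; apply: leq_trans kc _.
by rewrite -[X in _ <= X]card_ord max_card.
Qed.

Lemma optimal_value0 t d q : optimal_value I 0 t d q =
  if [&& t == 0, d == 0 & q == 0] then 0%E else -oo%E.
Proof.
have feas0 (x : selection I 0) : feasible t d q x = [&& t == 0, d == 0 & q == 0].
  rewrite /feasible !big_ord0 !(eq_sym 0); case: forallP => //= -[] [] //.
rewrite /optimal_value; case: ifP => [z | nz]; last first.
  by rewrite big_pred0 // => x; rewrite feas0.
rewrite (big_pred1 (finfun (fun _ => (ord0, ord0)) : selection I 0)).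
  by rewrite /selection_value big_ord0.
move=> x /=; rewrite feas0 z; apply/esym/eqP/ffunP => -[] //.
Qed.

(** Membership in the support of class c keeps k and dq in the ranges of the
    finite type of selections, so the extended selection can be formed. *)
Lemma optimal_value_extend c t d q k dq : class_support I c (k, dq) ->
  (optimal_value I c t d q + class_value I c k dq <=
   optimal_value I c.+1 (t + k) (maxn d k) (q + dq))%E.
Proof.
move=> supp; have [kn qb] := class_support_bounds supp.
have [opt0|[x /and4P[/forallP sx /eqP tx /eqP dx /eqP qx] eqx]] :=
  bigmaxe_attained (feasible t d q) (@selection_value I c).
  by rewrite /optimal_value opt0 addNye leNye.
(* insub fails exactly on the new, last index *)
pose y : selection I c.+1 := [ffun j : 'I_c.+1 =>
  if insub (j : nat) is Some j' then x j' else (inord k, inord dq)].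
have yw j : y (widen_ord (leqnSn c) j) = x j by rewrite ffunE /= valK.
have ym : y ord_max = (inord k, inord dq) by rewrite ffunE /= insubF ?ltnn.
rewrite [X in (X + _)%E]eqx.
apply: (@Order.TotalTheory.bigmax_sup _ _ _ _ y); last first.
  rewrite /selection_value big_ord_recr ym /= !inordK //.
  by under [X in (_ <= X + _)%E]eq_bigr do rewrite yw.
rewrite /feasible !big_ord_recr ym /= !inordK //; apply/and4P; split.
- apply/forallP => j; have [jc | jc] := ltnP j c.
    have -> : j = widen_ord (leqnSn c) (Ordinal jc) by apply: val_inj.
    by rewrite yw; apply: sx.
  have -> : j = ord_max by apply: val_inj => /=; have := ltn_ord j; lia.
  by rewrite ym /= !inordK.
- by under eq_bigr do rewrite yw; rewrite tx.
- by under eq_bigr do rewrite yw; rewrite dx.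
- by under eq_bigr do rewrite yw; rewrite qx.
Qed.

Lemma optimal_value_split c t d q (z : \bar int) :
  (forall t' d' q' k dq, class_support I c (k, dq) ->
     t' + k = t -> maxn d' k = d -> q' + dq = q ->
     (optimal_value I c t' d' q' + class_value I c k dq <= z)%E) ->
  (optimal_value I c.+1 t d q <= z)%E.
Proof.
move=> bound; apply: bigmax_le => [|x]; first exact: leNye.
case/and4P=> /forallP sx; rewrite !big_ord_recr /= => /eqP tx /eqP dx /eqP qx.
pose x' : selection I c := [ffun j => x (widen_ord (leqnSn c) j)].
apply: le_trans (bound _ _ _ _ _ (sx ord_max) tx dx qx).
rewrite /selection_value big_ord_recr leeD2r //.
apply: (@Order.TotalTheory.bigmax_sup _ _ _ _ x'); last first.
  by rewrite le_eqVlt; apply/orP; left; apply/eqP; apply: eq_bigr => j _; rewrite ffunE.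
rewrite /feasible; apply/and4P; split.
- by apply/forallP => j; rewrite ffunE; apply: sx (widen_ord _ j).
- by apply/eqP/eq_bigr => j _; rewrite ffunE.
- by apply/eqP/eq_bigr => j _; rewrite ffunE.
- by apply/eqP/eq_bigr => j _; rewrite ffunE.
Qed.

End Knapsack.

(** * Postconditions with operation bounds *)

Section Logic.
Variable n : nat.
Implicit Types (h : memory n) (Q : memory n -> Prop).

Definition runs (p : cmd n unit) h (k : nat) Q :=
  Q (final_memory p h) /\ cost p h <= k.

Lemma runs_conseq p h k1 k2 Q1 Q2 :
  runs p h k1 Q1 -> (forall h', Q1 h' -> Q2 h') -> k1 <= k2 -> runs p h k2 Q2.
Proof. by move=> [q1 c1] imp le; split; [apply: imp | apply: leq_trans le]. Qed.

Lemma runs_weaken p h k1 k2 Q : runs p h k1 Q -> k1 <= k2 -> runs p h k2 Q.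
Proof. by move=> pQ; apply: runs_conseq pQ _. Qed.

Lemma runs_seq p r h k1 k2 Q1 Q2 :
  runs p h k1 Q1 -> (forall h', Q1 h' -> runs r h' k2 Q2) ->
  runs (bind p (fun _ => r)) h (k1 + k2) Q2.
Proof.
rewrite /runs /final_memory /cost /bind.
case: (p h) => [[[] h1] c1] /= [q1 le1] /(_ _ q1).
by case: (r h1) => [[[] h2] c2] /= [q2 le2]; split=> //; apply: leq_add.
Qed.

Lemma runs_op A (a : A) r h k Q :
  runs (r a) h k Q -> runs (bind (op a) r) h k.+1 Q.
Proof.
rewrite /runs /final_memory /cost /bind /=.
by case: (r a h) => [[[] h2] c2] /= [].
Qed.

Lemma runs_get A (f : memory n -> A) r h k Q :
  runs (r (f h)) h k Q -> runs (bind (get f) r) h k.+1 Q.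
Proof.
rewrite /runs /final_memory /cost /bind /=.
by case: (r (f h) h) => [[[] h2] c2] /= [].
Qed.

Lemma runs_put w r h k Q :
  runs r (w h) k Q -> runs (bind (put w) (fun _ => r)) h k.+1 Q.
Proof.
rewrite /runs /final_memory /cost /bind /=.
by case: (r (w h)) => [[[] h2] c2] /= [].
Qed.

(** The invariant speaks of the list of elements already visited. The bound of
    an iteration may depend on the element, as needed for the loop over the
    colors, whose total is only small because the class sizes add up to n. *)
Lemma runs_foreach_sum A (s : seq A) body (k : A -> nat) Inv h :
  Inv [::] h ->
  (forall s1 x s2 h, s = s1 ++ x :: s2 -> Inv s1 h ->
     runs (body x) h (k x) (Inv (rcons s1 x))) ->
  runs (foreach s body) h (\sum_(x <- s) (k x).+1).+1 (Inv s).
Proof.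
move=> inv0 step.
have : forall s1 s2 h, s = s1 ++ s2 -> Inv s1 h ->
    runs (foreach s2 body) h (\sum_(x <- s2) (k x).+1).+1 (Inv s).
  move=> {inv0 h} s1 s2; elim: s2 s1 => [|x s2 IH] s1 h es inv.
    by split; rewrite // es cats0.
  rewrite /= big_cons addSn; apply: runs_op; rewrite -addnS.
  apply: runs_seq (step _ _ _ _ es inv) _ => h' inv'.
  by apply: IH inv'; rewrite cat_rcons.
by move=> /(_ [::] s h erefl inv0).
Qed.

Lemma runs_foreach A (s : seq A) body k Inv h :
  Inv [::] h ->
  (forall s1 x s2 h, s = s1 ++ x :: s2 -> Inv s1 h ->
     runs (body x) h k (Inv (rcons s1 x))) ->
  runs (foreach s body) h (size s * k.+1).+1 (Inv s).
Proof.
move=> inv0 step; have := runs_foreach_sum inv0 step.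
by rewrite big_const_seq count_predT iter_addn_0 mulnC.
Qed.

(** For loops whose iterations may come in any order: iteration x achieves G x,
    and G x persists because later memory changes respect the preorder R. *)
Lemma runs_each (A : eqType) (s : seq A) body k
    (J : memory n -> Prop) (R : memory n -> memory n -> Prop)
    (G : A -> memory n -> Prop) h :
  (forall h, R h h) -> (forall h1 h2 h3, R h1 h2 -> R h2 h3 -> R h1 h3) ->
  (forall x h1 h2, G x h1 -> R h1 h2 -> G x h2) -> J h ->
  (forall x h, x \in s -> J h ->
     runs (body x) h k (fun h' => [/\ J h', R h h' & G x h'])) ->
  runs (foreach s body) h (size s * k.+1).+1
    (fun h' => [/\ J h', R h h' & {in s, forall x, G x h'}]).
Proof.
move=> Rrefl Rtrans stable Jh step.
apply: (runs_foreach (Inv := fun s1 h' =>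
  [/\ J h', R h h' & {in s1, forall x, G x h'}])) => [|s1 x s2 h1 es [J1 R1 G1]].
  by split.
have xs : x \in s by rewrite es mem_cat mem_head orbT.
apply: runs_conseq (step _ _ xs J1) _ (leqnn _) => h2 [J2 R2 G2].
split=> // [|y]; first exact: Rtrans R2.
rewrite mem_rcons inE => /orP[/eqP-> // | ys]; exact: stable (G1 _ ys) R2.
Qed.

Lemma runs_up a N body k Inv h :
  Inv a h ->
  (forall j h, a <= j < a + N -> Inv j h -> runs (body j) h k (Inv j.+1)) ->
  runs (foreach (iota a N) body) h (N * k.+1).+1 (Inv (a + N)).
Proof.
move=> inv0 step.
have := @runs_foreach _ (iota a N) body k (fun s1 => Inv (a + size s1)) h.
rewrite size_iota addn0; apply=> // s1 x s2 h1 es inv.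
have ltN : size s1 < N by rewrite -(size_iota a N) es size_cat /= addnS ltnS leq_addr.
have ex : x = a + size s1.
  by rewrite -(nth_iota 0 a ltN) es nth_cat ltnn subnn.
rewrite size_rcons addnS -ex in inv *; apply: step => //; lia.
Qed.

Lemma runs_down N body k Inv h :
  Inv N h ->
  (forall j h, 0 < j <= N -> Inv j h -> runs (body j) h k (Inv j.-1)) ->
  runs (foreach (rev (iota 1 N)) body) h (N * k.+1).+1 (Inv 0).
Proof.
elim: N h => [|N IH] h inv step; first by split.
rewrite -[X in iota 1 X]addn1 iotaD rev_cat add1n /=.
have -> : (N.+1 * k.+1).+1 = (k + (N * k.+1).+1).+1 by lia.
apply: runs_op.
apply: runs_seq (step _ _ _ inv) _ => [|h1 inv1]; first by rewrite leqnn.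
apply: IH inv1 _ => j h2 /andP[j0 jN]; apply: step; lia.
Qed.

End Logic.

(** Keeps bounds in the form of a constant times the product of the loop
    lengths, so that the bounds of nested loops compose. *)
Lemma loop_cost L k c X : 0 < L -> 0 < X -> k <= c * X ->
  (L * k.+1).+1 <= c.+2 * (L * X).
Proof.
move=> L0 X0 kX; apply: (@leq_trans (L * (c.+1 * X)).+1).
  by rewrite ltnS leq_mul2l mulSn -add1n leq_add ?orbT.
rewrite mulnCA (mulSn c.+1) addnC -addn1 leq_add2l muln_gt0 L0 //.
Qed.

Section RangeLoops.
Variables (n : nat) (J : memory n -> Prop) (R : memory n -> memory n -> Prop).
Hypothesis Rrefl : forall h, R h h.
Hypothesis Rtrans : forall h1 h2 h3, R h1 h2 -> R h2 h3 -> R h1 h3.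

(** [J] is what the loop keeps true, [R] how memories evolve under it; both are
    reproduced by the conclusion so that the lemma applies to its own body. *)
Lemma runs_range L X c body (G : nat -> memory n -> Prop) h :
  0 < L -> 0 < X -> J h ->
  (forall x h1 h2, G x h1 -> R h1 h2 -> G x h2) ->
  (forall x h, x < L -> J h ->
     runs (body x) h (c * X) (fun h' => [/\ J h', R h h' & G x h'])) ->
  runs (foreach (iota 0 L) body) h (c.+2 * (L * X))
    (fun h' => [/\ J h', R h h' & forall x, x < L -> G x h']).
Proof.
move=> L0 X0 Jh stable step.
apply: runs_conseq (runs_each (s := iota 0 L) Rrefl Rtrans stable Jh _) _ _.
- by move=> x h1; rewrite mem_iota add0n => xL; apply: step xL.
- by move=> h1 [J1 R1 G1]; split=> // x xL; apply: G1; rewrite mem_iota.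
by rewrite size_iota; apply: loop_cost.
Qed.

End RangeLoops.

(** * The phases of the algorithm *)

Section Programs.
Variable I : ckp.
Local Notation n := (num_items I).
Local Notation m := (num_colors I).
Local Notation b := (capacity I).
Implicit Types h : memory n.

Lemma initialize_runs h :
  runs (@initialize I) h (10 * (m.+1 * (n.+1 * (n.+1 * b.+1)))) (fun h' =>
    forall c t d q, c <= m -> t <= n -> d <= n -> q <= b ->
      tab_f h' (c, t, d, q) =
        if (c, t, d, q) == (0, 0, 0, 0) then 0%E else -oo%E).
Proof.
pose R h1 h2 := forall s, tab_f h1 s = -oo%E -> tab_f h2 s = -oo%E.
have Rrefl h1 : R h1 h1 by [].
have Rtrans h1 h2 h3 : R h1 h2 -> R h2 h3 -> R h1 h3.
  by move=> R1 R2 s /R1 /R2.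
have range := @runs_range n (fun _ => True) R Rrefl Rtrans.
rewrite /initialize.
apply: (@runs_conseq _ _ _ (9 * (m.+1 * (n.+1 * (n.+1 * b.+1))) + 1) _);
  [|by move=> h'; apply |]; last first.
  by rewrite -[10]addn1 mulnDl mul1n leq_add2l !muln_gt0.
apply: (@runs_seq _ _ _ _ _ _ (fun h' => [/\ True, R h h' &
  forall c, c < m.+1 -> forall t, t < n.+1 -> forall d, d < n.+1 ->
  forall q, q < b.+1 -> tab_f h' (c, t, d, q) = -oo%E])); last first.
  move=> h1 [_ _ inf]; split=> // c t d q cm tn dn qb.
  by rewrite /final_memory /=; case: eqP => // _; apply: inf.
apply: (range); rewrite ?muln_gt0 //.
  by move=> c h1 h2 G R12 t tn d dn q qb; apply: R12; apply: G.
move=> c h1 _ _; apply: (range); rewrite ?muln_gt0 //.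
  by move=> t h2 h3 G R12 d dn q qb; apply: R12; apply: G.
move=> t h2 _ _; apply: (range); rewrite ?muln_gt0 //.
  by move=> d h3 h4 G R12 q qb; apply: R12; apply: G.
move=> d h3 _ _; rewrite -[X in 3 * X]muln1; apply: (range); rewrite ?muln1 //.
  by move=> q h4 h5 G R12; apply: R12; apply: G.
move=> q h4 _ _; split=> //; split=> // [s es|] /=; first by case: eqP.
by rewrite eqxx.
Qed.

Lemma collect_class_runs (c : 'I_m) h :
  runs (collect_class c) h (8 * n).+3 (fun h' =>
    [/\ tab_f h' = tab_f h, uniq (items_c h'),
        [set i in items_c h'] = color_class I c &
        size_c h' = #|color_class I c|]).
Proof.
pose Inv (s1 : seq 'I_n) h' := [/\ tab_f h' = tab_f h,
  items_c h' = rev [seq i <- s1 | color i == c] &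
  size_c h' = size (items_c h')].
apply: runs_put; apply: runs_put; apply: runs_conseq.
- apply: (runs_foreach (Inv := Inv) (k := 7)) => [|s1 i s2 h1 _ [ef ei es]].
    by split.
  rewrite /Inv filter_rcons; do 2 apply: runs_op.
  case: ifP => _; last by split; rewrite // ei.
  apply: runs_get; apply: runs_put; apply: runs_get; apply: runs_op.
  by split; rewrite // rev_rcons /final_memory /= es ei.
- move=> h1 [-> ei ->].
  have eset : [set i in items_c h1] = color_class I c.
    by apply/setP => i; rewrite !inE ei mem_rev mem_filter mem_enum andbT.
  have ui : uniq (items_c h1) by rewrite ei rev_uniq filter_uniq ?enum_uniq.
  by split=> //; rewrite -eset cardsE (card_uniqP ui).
by rewrite size_enum_ord mulnC.
Qed.

Definition same_class h h' :=
  [/\ tab_f h' = tab_f h, items_c h' = items_c h & size_c h' = size_c h].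

Lemma inner_init_runs h K : 0 < K ->
  runs (foreach (iota 0 K) (fun k => foreach (iota 0 b.+1) (fun q =>
         @write_g n (k, q) -oo%E))) h (5 * (K * b.+1)) (fun h' =>
    same_class h h' /\
    forall k, k < K -> forall q, q < b.+1 -> tab_g h' (k, q) = -oo%E).
Proof.
move=> K0; pose R h1 h2 := forall s, tab_g h1 s = -oo%E -> tab_g h2 s = -oo%E.
have Rrefl h1 : R h1 h1 by [].
have Rtrans h1 h2 h3 : R h1 h2 -> R h2 h3 -> R h1 h3.
  by move=> R1 R2 s /R1 /R2.
have range := @runs_range n (same_class h) R Rrefl Rtrans.
suff : runs (foreach (iota 0 K) (fun k => foreach (iota 0 b.+1) (fun q =>
         @write_g n (k, q) -oo%E))) h (5 * (K * b.+1)) (fun h' =>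
    [/\ same_class h h', R h h' &
      forall k, k < K -> forall q, q < b.+1 -> tab_g h' (k, q) = -oo%E]).
  by move=> H; apply: runs_conseq H _ (leqnn _) => h1 [].
apply: (range) => //.
  by move=> k h1 h2 G R12 q qb; apply: R12; apply: G.
move=> k h1 _ J1; rewrite -[X in 3 * X]muln1; apply: (range) => //.
  by move=> q h2 h3 G R12; apply: R12; apply: G.
move=> q h2 _ J2; split=> //; split=> // [s es|] /=; first by case: eqP.
by rewrite eqxx.
Qed.

(** The set behind the table entry (k, q) is i |: A when the entry has been
    updated and A when it has not. Both loops advance this frontier: k runs
    downwards, so that row k - 1, read while row k is updated, is still
    entirely on the side of A. Row 0 and the weights below the weight of i
    are never visited, and there the values for A and i |: A agree. *)
Lemma insert_item_runs (A : {set 'I_n}) (i : 'I_n) nc h : i \notin A -> 0 < nc ->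
  (forall k q, k <= nc -> q <= b -> tab_g h (k, q) = subset_value A k q) ->
  runs (foreach (rev (iota 1 nc)) (fun k =>
     foreach (iota (weight i) (b.+1 - weight i)) (fun q =>
      (k1 <-- op k.-1;;
      q1 <-- op (q - weight i);;
      v <-- read_g (k1, q1);;
      new <-- op (v + (profit i)%:E)%E;;
      old <-- read_g (k, q);;
      best <-- op (maxe old new);;
      write_g (k, q) best)%cmd))) h (11 * (nc * b.+1)) (fun h' =>
    same_class h h' /\
    forall k q, k <= nc -> q <= b ->
      tab_g h' (k, q) = subset_value (i |: A) k q).
Proof.
move=> iA nc0 gA.
pose done (D : nat -> nat -> bool) h' := same_class h h' /\
  forall k q, k <= nc -> q <= b -> tab_g h' (k, q) =
    subset_value (if D k q then i |: A else A) k q.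
apply: runs_conseq.
- apply: (runs_down (k := (b.+1 * 8).+1)
    (Inv := fun j => done (fun k _ => j < k))) => [|j h1 /andP[j0 jnc] D1].
    split=> // k q knc qb; rewrite ltnNge knc; exact: gA.
  apply: runs_conseq.
  + apply: (runs_up (k := 7) (Inv := fun x =>
      done (fun k q => (j < k) || (k == j) && (q < x)))) => [|x h2 xw D2].
      have [fr gD] := D1; split=> // k q knc qb; rewrite gD //.
      case: ltnP => //= kj; case: eqP => //= -> {kj}; case: ltnP => // qw.
      by rewrite subset_valueU1 // (leqNgt (weight i)) qw andbF maxeNy.
    (* only column q = x of row j is written, with the recursion for i |: A *)
    have [fr gD] := D2; do 2 apply: runs_op; apply: runs_get; apply: runs_op; apply: runs_get; apply: runs_op; split=> //.
    split=> // k q knc qb; rewrite /final_memory /=.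
    case: eqP => [[-> ->]|ne].
      rewrite !gD ?leq_subLR; try lia.
      have [-> ->] : (j < j.-1) = false /\ (j.-1 == j) = false.
        by split; lia.
      rewrite !ltnn !eqxx ltnS leqnn /=.
      by rewrite subset_valueU1 // j0 (_ : weight i <= x) //; lia.
    rewrite gD //; case: (ltnP j k) => //= kj; case: eqP => //= kej.
    by rewrite ltnS [q <= x]leq_eqVlt; case: eqP => // qx; case: ne; rewrite kej qx.
  + move=> h2 [fr gD]; split=> // k q knc qb; rewrite gD //.
    rewrite (_ : _ || _ = (j.-1 < k)) //.
    by rewrite (_ : q < _ + _); lia.
  by rewrite ltnS leq_mul2r leq_subr orbT.
- move=> h1 [fr gD]; split=> // k q knc qb; rewrite gD //.
  by case: posnP => // ->; rewrite subset_valueU1 //= maxeNy.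
by apply: (loop_cost (c := 9)) => //; lia.
Qed.

Lemma inner_dp_runs h nc :
  uniq (items_c h) -> size_c h = nc -> nc = size (items_c h) -> 0 < nc ->
  runs (@inner_dp I) h (22 * (nc * (nc.+1 * b.+1)))
    (fun h' => [/\ tab_f h' = tab_f h, size_c h' = nc &
      forall k q, k <= nc -> q <= b ->
        tab_g h' (k, q) = subset_value [set i in items_c h] k q]).
Proof.
move=> ui ec es nc0; rewrite /inner_dp; apply: runs_conseq.
- apply: runs_get; rewrite ec; apply: runs_seq (inner_init_runs h (ltn0Sn nc)) _ => h1 [[ef ei ez] ginf].
  apply: runs_put; apply: runs_get => /=; rewrite ei.
  apply: (runs_foreach (k := (11 * (nc * b.+1)).+2) (Inv := fun s1 h' =>
    [/\ tab_f h' = tab_f h, size_c h' = nc & forall k q, k <= nc -> q <= b ->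
        tab_g h' (k, q) = subset_value [set i in s1] k q])).
    split=> [||k q knc qb] /=; rewrite ?ez // set_nil subset_value0 -xpair_eqE.
    by case: eqP => // _; apply: ginf.
  move=> s1 i s2 h2 eh [ef2 ez2 gD].
  have iA : i \notin [set x in s1].
    by move: ui; rewrite eh cat_uniq /= inE negb_or => /and3P[_ /andP[]].
  do 2 apply: runs_op.
  apply: runs_conseq (insert_item_runs iA nc0 gD) _ (leqnn _) => h3 [[ef3 ei3 ez3] g3].
  split=> [||k q knc qb]; rewrite ?ef3 ?ez3 //.
  rewrite g3 //; congr subset_value.
  by apply/setP => x; rewrite !inE mem_rcons inE.
- by [].
rewrite -es; have : nc <= nc * b.+1 by rewrite leq_pmulr.
have : b.+1 <= nc * b.+1 by rewrite leq_pmull.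
by lia.
Qed.

(** The support has at most one element per table entry; this is what bounds
    the innermost loop of the outer step. *)
Lemma collect_support_runs h nc (K := nc.+1) : size_c h = nc ->
  runs (@collect_support I) h (10 * (K * b.+1)) (fun h' =>
    [/\ tab_f h' = tab_f h, tab_g h' = tab_g h, size (supp_c h') <= K * b.+1 &
      forall k q, ((k, q) \in supp_c h') =
        [&& k < K, q <= b & (-oo < tab_g h (k, q))%E]]).
Proof.
move=> ec; pose fin kq := (-oo < tab_g h kq)%E.
pose done s h' := [/\ tab_f h' = tab_f h, tab_g h' = tab_g h &
  supp_c h' = rev [seq kq <- s | fin kq]].
rewrite /collect_support; apply: runs_conseq.
- apply: runs_get; rewrite ec; apply: runs_put.
  apply: (runs_foreach (k := (b.+1 * 5).+1)
    (Inv := fun ks => done [seq (k, q) | k <- ks, q <- iota 0 b.+1])) => //.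
  move=> ks k ks2 h1 _ D1; rewrite allpairs_rcons; apply: runs_conseq.
  + apply: (runs_foreach (k := 4) (Inv := fun qs => done
      ([seq (k, q) | k <- ks, q <- iota 0 b.+1] ++ [seq (k, q) | q <- qs]))).
      by rewrite cats0.
    move=> qs q qs2 h2 _ [ef eg es].
    rewrite map_rcons -rcons_cat /done filter_rcons.
    apply: runs_get; apply: runs_op; rewrite eg -/(fin _); case: ifP => _.
      by apply: runs_get; split; rewrite // /final_memory /= rev_rcons es.
    by split.
  + by [].
  by rewrite size_iota.
- move=> h1 [-> -> ->]; split=> // [|k q]; last first.
    rewrite mem_rev mem_filter andbC andbA; congr andb.
    apply/allpairsP/andP => [[[k' q'] [+ + [-> ->]]]|[kK qb]].
      by rewrite !mem_iota.
    by exists (k, q); rewrite !mem_iota.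
  rewrite size_rev size_filter; apply: leq_trans (count_size _ _) _.
  by rewrite size_allpairs !size_iota.
rewrite size_iota -/K; have : b.+1 <= K * b.+1 by rewrite leq_pmull.
have : K <= K * b.+1 by rewrite leq_pmulr.
by lia.
Qed.

Definition in_range t d q := [&& t <= n, d <= n & q <= b].

(** Upper bounds on layer c + 1 are an invariant, since every value written is
    the maximum of the old one and the value of an extension. Lower bounds are
    achieved by the single iterations and persist because entries only grow.
    When the entry read is -oo the iteration is skipped, and the lower bound it
    would have achieved is trivially true. *)
Lemma outer_step_runs c X h :
  (forall k q, ((k, q) \in supp_c h) = class_support I c (k, q)) ->
  (forall k q, class_support I c (k, q) -> tab_g h (k, q) = class_value I c k q) ->
  (forall t d q, in_range t d q -> tab_f h (c, t, d, q) = optimal_value I c t d q) ->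
  (forall t d q, in_range t d q -> tab_f h (c.+1, t, d, q) = -oo%E) ->
  0 < X -> size (supp_c h) <= X ->
  runs (@outer_step I c) h (21 * (n.+1 * (n.+1 * (b.+1 * X)))) (fun h' =>
    (forall c' t d q, c' != c.+1 -> tab_f h' (c', t, d, q) = tab_f h (c', t, d, q)) /\
    (forall t d q, in_range t d q ->
       tab_f h' (c.+1, t, d, q) = optimal_value I c.+1 t d q)).
Proof.
move=> suppE gE layer next X0 suppX.
pose J h1 := [/\ tab_g h1 = tab_g h, supp_c h1 = supp_c h,
  forall c' t d q, c' != c.+1 -> tab_f h1 (c', t, d, q) = tab_f h (c', t, d, q) &
  forall t d q, in_range t d q ->
    (tab_f h1 (c.+1, t, d, q) <= optimal_value I c.+1 t d q)%E].
pose R h1 h2 := forall s, (tab_f h1 s <= tab_f h2 s)%E.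
have Rrefl h1 : R h1 h1 by move=> s.
have Rtrans h1 h2 h3 : R h1 h2 -> R h2 h3 -> R h1 h3.
  by move=> R1 R2 s; apply: le_trans (R1 s) (R2 s).
have Jh : J h by split=> // t d q tdq; rewrite next // leNye.
(* what a single visit of the entry (t, d, q) and the pair kq achieves *)
pose relaxed t d q kq h1 := q + kq.2 <= b ->
  (tab_f h (c, t, d, q) + tab_g h kq <=
   tab_f h1 (c.+1, (t + kq.1)%N, maxn d kq.1, (q + kq.2)%N))%E.
have stable t d q kq h1 h2 : relaxed t d q kq h1 -> R h1 h2 -> relaxed t d q kq h2.
  by move=> G R12 qb; apply: le_trans (G qb) (R12 _).
have range := @runs_range n J R Rrefl Rtrans.
rewrite /outer_step.
apply: (@runs_conseq _ _ _ (21 * (n.+1 * (n.+1 * (b.+1 * X)))) _ (fun h' =>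
  [/\ J h', R h h' & forall t, t < n.+1 -> forall d, d < n.+1 -> forall q,
     q < b.+1 -> forall kq, kq \in supp_c h -> relaxed t d q kq h'])) => //; last first.
  move=> h' [[_ _ same upper] _ done]; split=> // t d q tdq.
  apply/le_anti; rewrite upper //=; have /and3P[tn dn qb] := tdq.
  apply: optimal_value_split => t' d' q' k dq sk et ed eq.
  have := @done t' _ d' _ q' _ (k, dq) _.
  rewrite /relaxed /= suppE et ed eq layer ?gE; last by apply/and3P; split; lia.
    by apply=> //; lia.
  by [].
apply: (range); rewrite ?muln_gt0 //.
  by move=> t h1 h2 G R12 d dn q qb kq ks; apply: stable R12; apply: G.
move=> t h1 tn J1; apply: (range); rewrite ?muln_gt0 //.
  by move=> d h2 h3 G R12 q qb kq ks; apply: stable R12; apply: G.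
move=> d h2 dn J2; apply: (range) => //.
  by move=> q h3 h4 G R12 kq ks; apply: stable R12; apply: G.
move=> q h3 qb J3; have [eg es same upper] := J3.
(* 12 X bounds the loop over the support, with at most 10 operations and a
   loop test per pair; the rest covers reading and testing the entry *)
have -> : 15 * X = (12 * X + 3 * X) by rewrite -mulnDl.
apply: runs_weaken.
- apply: runs_get; rewrite same; last by rewrite neq_ltn ltnSn.
  apply: (runs_op (k := (X * 11).+2)); case: ifPn => [fv|]; last first.
    rewrite ltNge negbK leeNy_eq => /eqP fv; split=> //; split=> // kq _ _.
    by rewrite fv addNye leNye.
  apply: runs_get; rewrite es; apply: runs_weaken.
  + apply: (runs_each (k := 10) Rrefl Rtrans (@stable t d q) J3).
    move=> [k dq] h4; rewrite suppE => sk J4.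
    have [eg4 es4 same4 upper4] := J4.
    do 2 apply: runs_op; case: ifPn => [fits|]; last first.
      by move=> nfit; split=> //; split=> // fit; rewrite fit in nfit.
    do 3 apply: runs_op; do 2 apply: runs_get; do 2 apply: runs_op.
    rewrite eg4; split=> //; split.
    * split=> // [c' t' d' q' ne|t' d' q' tdq]; rewrite /final_memory /=.
        by case: eqP => [[ec]|_]; [rewrite ec eqxx in ne | apply: same4].
      case: eqP => [[et ed eq]|_]; last exact: upper4.
      rewrite et ed eq in tdq *; rewrite ge_max upper4 //=.
      rewrite layer ?gE //; first exact: optimal_value_extend.
      by apply/and3P.
    * move=> s; rewrite /final_memory /=; case: eqP => // ->.
      by rewrite le_max lexx.
    * by rewrite /relaxed /final_memory /= eqxx => _; rewrite le_max lexx orbT.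
  by rewrite ltnS leq_mul2r suppX orbT.
by lia.
Qed.

Lemma sum_class_sizes : \sum_(c < m) #|color_class I c| = n.
Proof.
under eq_bigr do rewrite -sum1_card.
rewrite -[RHS]card_ord -sum1_card (partition_big (@color I) xpredT) //=.
by apply: eq_bigr => c _; apply: eq_bigl => i; rewrite inE.
Qed.

Lemma color_class_gt0 (c : 'I_m) : 0 < #|color_class I c|.
Proof. by have [i ic] := color_surj c; apply/card_gt0P; exists i; rewrite inE ic. Qed.

Lemma num_items_gt0 : 0 < n.
Proof.
rewrite lt0n; apply/eqP => n0; have := capacity_lt_sum I.
by rewrite big1 // => i _; have := ltn_ord i; rewrite {2}n0.
Qed.

Lemma num_colors_le : m <= n.
Proof.
rewrite -[X in _ <= X]sum_class_sizes -[X in X <= _]card_ord -sum1_card.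
by apply: leq_sum => c _; apply: color_class_gt0.
Qed.

(** A color of class size K costs at most 67 N^2 B^2 (K + 1), the constant
    exceeding the sum 8 + 22 + 10 + 21 of those of its four phases; 3000
    exceeds 160 for the initialization plus 68 * 32 for all colors. *)
Lemma DP2_runs h :
  runs (DP2 I) h (3000 * (b ^ 2 * n ^ 3)) (fun h' => forall c t d q,
    c <= m -> in_range t d q -> tab_f h' (c, t, d, q) = optimal_value I c t d q).
Proof.
(* after the first size s colors the layers up to size s are final, and the
   later ones are still empty *)
pose Inv (s : seq 'I_m) h' := forall c t d q, c <= m -> in_range t d q ->
  tab_f h' (c, t, d, q) = if c <= size s then optimal_value I c t d q else -oo%E.
pose N2B2 := n.+1 * (n.+1 * (b.+1 * b.+1)).
apply: runs_conseq.
- rewrite /DP2; apply: runs_seq (initialize_runs h) _ => h1 init.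
  apply: (runs_foreach_sum (Inv := Inv)
    (k := fun c : 'I_m => 67 * (N2B2 * #|color_class I c|.+1))).
    move=> c t d q cm /and3P[tn dn qb]; rewrite init // leqn0.
    case: c {cm} => [|c] //; rewrite optimal_value0 !xpair_eqE eqxx /=.
    by rewrite -andbA.
  move=> s1 c s2 h2 es inv2.
  (* colors are enumerated in increasing order *)
  have ec : c = size s1 :> nat.
    have lt : size s1 < size (enum 'I_m) by rewrite es size_cat /= addnS ltnS leq_addr.
    rewrite size_enum_ord in lt; rewrite -[RHS](nth_enum_ord c lt) es.
    by rewrite nth_cat ltnn subnn.
  pose K := #|color_class I c|; have K0 : 0 < K by apply: color_class_gt0.
  apply: runs_weaken.
  + apply: runs_seq (collect_class_runs c h2) _ => h3 [ef3 ui eset esz].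
    have eC : K = size (items_c h3) by rewrite /K -eset cardsE (card_uniqP ui).
    apply: runs_seq (inner_dp_runs ui esz eC K0) _ => h4 [ef4 ez4 g4].
    apply: runs_seq (collect_support_runs ez4) _ => h5 [ef5 eg5 size5 supp5].
    rewrite eset in g4.
    have suppE k q : ((k, q) \in supp_c h5) = class_support I c (k, q).
      rewrite supp5 /class_support /= ltnS -/K.
      by case: leqP => //= kK; case: leqP => //= qb; rewrite g4.
    have ef : tab_f h5 = tab_f h2 by rewrite ef5 ef4 ef3.
    apply: runs_conseq.
    * apply: (outer_step_runs suppE _ _ _ _ size5).
      - move=> k q; rewrite -suppE supp5 eg5 => /and3P[kK qb _].
        exact: g4.
      - by move=> t d q tdq; rewrite ef inv2 ?(ltnW (ltn_ord c)) // ec leqnn.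
      - by move=> t d q tdq; rewrite ef inv2 ?ltn_ord // ec ltnn.
      - by rewrite muln_gt0.
    * move=> h6 [same next] c' t d q cm tdq; rewrite size_rcons -ec.
      have [->|ne] := eqVneq c' c.+1; first by rewrite leqnn next.
      by rewrite same // ef inv2 // -ec [c' <= c.+1]leq_eqVlt (negPf ne).
    exact: leqnn.
  have Kn : K <= n by rewrite /K -[X in _ <= X](card_ord n) max_card.
  rewrite /N2B2 -/K; move: (leq0n b) Kn; set B := b.+1; set N := n.+1.
  have NE : N = n.+1 by []. have B0 : 0 < B by [].
  move=> _ Kn; pose Z := N * (N * (B * B)) * K.+1.
  have ZE : N * (N * (B * (K.+1 * B))) = Z by rewrite /Z; nia.
  have Z1 : N <= Z by rewrite /Z -!mulnA leq_pmulr // !muln_gt0 B0.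
  have Z3 : K * (K.+1 * B) <= Z.
    rewrite (_ : Z = N * (K.+1 * B) * (N * B)); last by rewrite /Z; lia.
    by rewrite (leq_trans (leq_mul (leqW Kn) (leqnn _))) // leq_pmulr // muln_gt0.
  have Z2 : K.+1 * B <= Z by apply: leq_trans Z3; rewrite leq_pmull.
  by rewrite ZE -/Z; lia.
- move=> h2 inv2 c t d q cm tdq; rewrite inv2 //.
  by rewrite size_enum_ord cm.
have n0 := num_items_gt0; have b0 := capacity_gt0 I; have mn := num_colors_le.
have N2B2_le : N2B2 <= 16 * (b ^ 2 * n ^ 2).
  have N2 : n.+1 <= 2 * n by lia.
  have B2 : b.+1 <= 2 * b by lia.
  apply: (@leq_trans (2 * n * (2 * n * (2 * b * (2 * b))))); last by nia.
  by rewrite /N2B2 !leq_mul.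
have classes : \sum_(c : 'I_m) #|color_class I c|.+1 <= 2 * n.
  under eq_bigr do rewrite -addn1.
  by rewrite big_split /= sum_class_sizes sum1_card card_ord; lia.
have init_le : m.+1 * (n.+1 * (n.+1 * b.+1)) <= 16 * (b ^ 2 * n ^ 3).
  apply: (@leq_trans (2 * n * (2 * n * (2 * n * (2 * b))))).
    by rewrite !leq_mul //; lia.
  by nia.
have loop_le : \sum_(c <- enum 'I_m) (67 * (N2B2 * #|color_class I c|.+1)).+1
    <= 68 * (N2B2 * (2 * n)).
  rewrite big_enum /=.
  apply: (@leq_trans (\sum_(c < m) 68 * N2B2 * #|color_class I c|.+1)).
    apply: leq_sum => c _.
    have : 0 < N2B2 * #|color_class I c|.+1 by rewrite !muln_gt0.
    by rewrite -mulnA; move: (N2B2 * _) => x; lia.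
  by rewrite -big_distrr /= mulnA leq_mul2l classes orbT.
have last_le : N2B2 * (2 * n) <= 32 * (b ^ 2 * n ^ 3).
  apply: leq_trans (leq_mul N2B2_le (leqnn _)) _; rewrite (expnSr n 2); lia.
have : 0 < b ^ 2 * n ^ 3 by rewrite muln_gt0 !expn_gt0 n0 b0.
move: loop_le last_le init_le => /=.
move: (\sum_(_ <- _) _) (N2B2 * _) (m.+1 * _) (b ^ 2 * _) => u v w x; lia.
Qed.

End Programs.

Theorem proposition3 :
  (forall (I : ckp) (h : memory (num_items I)) (c t d q : nat),
      c <= num_colors I -> t <= num_items I -> d <= num_items I ->
      q <= capacity I ->
      tab_f (final_memory (DP2 I) h) (c, t, d, q) = optimal_value I c t d q) /\
  (exists K : nat, forall (I : ckp) (h : memory (num_items I)),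
      cost (DP2 I) h <= K * (capacity I ^ 2 * num_items I ^ 3)).
Proof.
split=> [I h c t d q cm tn dn qb|].
  have [value _] := DP2_runs h; apply: value => //; exact/and3P.
by exists 3000 => I h; have [] := DP2_runs h.
Qed.
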